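(* The P-FETI-DP preconditioner and the BDDC preconditioner are the same, i.e. $M_{P-FETI-DP}=M_{BDDC}$ as linear operators $\widehat{W}'\to\widehat{W}$, where $$M_{P-FETI-DP}=E_rS_{rr}^{-1}E_r^T+\left(E_c-E_rS_{rr}^{-1}S_{rc}R_c\right)(\widetilde{S}_{cc}^{\ast})^{-1}\left(E_c^T-R_c^TS_{rc}^TS_{rr}^{-1}E_r^T\right)$$ and $$M_{BDDC}=E_rS_{rr}^{-1}E_r^T+E\Psi\left(\Psi^TS\Psi\right)^{-1}\Psi^TE^T .$$
   Context: All spaces are finite-dimensional real vector spaces, with operators identified with matrices in coordinates and duals identified by the standard inner product. Substructuring setting. A domain is decomposed into substructures $\Omega_1,\dots,\Omega_N$. $W_i$ is the space of vectors of local degrees of freedom on the interface of substructure $i$, $W=W_1\times\cdots\times W_N$, and $S=\mathrm{diag}(S_1,\dots,S_N)$, where each $S_i:W_i\to W_i$ (local Schur complement) is symmetric positive semidefinite. $\widehat{W}\subset W$ is the subspace of vectors whose degrees of freedom coincide on the interfaces between substructures; $R:\widehat{W}\to W$ is the natural embedding; the bilinear form $a(u,v)=\langle Su,v\rangle$ is positive definite on $\widehat{W}$. The averaging operator $E:W\to\widehat{W}$ is $E=R^TD_P$, with $D_P:W\to W$ a given weight matrix such that $ER=I$. Coarse degrees of freedom. It is assumed that every coarse degree of freedom (constraint) is represented by an explicit degree of freedom. Accordingly, the vectors in each $W_i$ split into coarse components (subscript $c$) and remaining components (subscript $r$), and, after ordering all coarse components first, $$S=\begin{pmatrix}S_{cc}&S_{rc}^T\\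 S_{rc}&S_{rr}\end{pmatrix},$$ where $S_{cc},S_{rc},S_{rr}$ are block diagonal with blocks $S_{cc}^{(i)},S_{rc}^{(i)},S_{rr}^{(i)}$, $i=1,\dots,N$. $R_c=(R_c^{(1)};\dots;R_c^{(N)})$ (stacked vertically), where $R_c^{(i)}$ maps the vector $u_c$ of global coarse degrees of freedom to its component $u_c^{(i)}$ on substructure $i$. The subspace $\widetilde{W}$ with $\widehat{W}\subset\widetilde{W}\subset W$ consists of the vectors with coarse part $R_cu_c$ for some global coarse vector $u_c$ and arbitrary remaining part $u_r$; it is assumed that $a$ is positive definite on $\widetilde{W}$ (so $S_{rr}$ and the matrix $\widetilde{S}_{cc}^{\ast}$ below are invertible). Notation in the preconditioners. $E_r$ is the restriction of $E$ to vectors with zero coarse part, regarded as a map of the remaining components: $E_ru_r=E\begin{pmatrix}0\\ u_r\end{pmatrix}$; and $E_cu_c=E\begin{pmatrix}R_cu_c\\ 0\end{pmatrix}$. Thus $E_r^T$ and $E_c^T$ distribute a primal residual to the subdomain forces and to the global coarse right-hand side, respectively. Further, $$\widetilde{S}_{cc}=\sum_{i=1}^NR_c^{(i)T}S_{cc}^{(i)}R_c^{(i)},\qquad \widetilde{S}_{cc}^{\ast}=\widetilde{S}_{cc}-R_c^TS_{rc}^TS_{rr}^{-1}S_{rc}R_c .$$ In $M_{BDDC}$, the columns of $\Psi$ are the coarse basis functions: $\Psi$ is the minimizer of $\operatorname{tr}\Psi^TS\Psi$ among all matrices whose coarse block equals $R_c$, i.e. each column has value $1$ at one global coarse degree of freedom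 and $0$ at the other ones, with energy-minimal extension to the remaining degrees of freedom. *)

(* Defs.v *)
From HB Require Import structures.
From mathcomp Require Import all_boot all_order all_algebra.
From mathcomp Require Import reals.

Set Implicit Arguments.
Unset Strict Implicit.
Unset Printing Implicit Defensive.

Import Order.TTheory GRing.Theory Num.Theory.
Local Open Scope ring_scope.

(* Substructure i has nc i coarse and nr i remaining local degrees of         *)
(* freedom, so W_i = 'cV_(nc i + nr i).  The product W of the W_i is          *)
(* 'cV_(\sum_i nc i + \sum_i nr i): all coarse components come first.         *)

Definition dotv (K : realType) (p : nat) (u v : 'cV[K]_p) : K :=
  (u^T *m v) 0 0.

Definition sym_psd (K : realType) (p : nat) (A : 'M[K]_p) : Prop :=
  A^T = A /\ forall u : 'cV[K]_p, 0 <= dotv (A *m u) u.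

(* Same as mxdiag, but with blocks that need not be square. *)
Definition mxdiag_rect (K : realType) (N : nat) (p q : 'I_N -> nat)
    (B : forall i, 'M[K]_(p i, q i)) : 'M[K]_(\sum_i p i, \sum_i q i) :=
  \mxblock_(i, j) (if i == j then conform_mx 0 (B i) else 0).

Section Substructuring.
Context {K : realType} {N : nat} {nc nr : 'I_N -> nat}.

(* Stacks the A i after moving all coarse rows first. *)
Definition glue (p : nat) (A : forall i, 'M[K]_(nc i + nr i, p)) :
    'M[K]_(\sum_i nc i + \sum_i nr i, p) :=
  col_mx (\mxcol_i usubmx (A i)) (\mxcol_i dsubmx (A i)).

Definition local (w : 'cV[K]_(\sum_i nc i + \sum_i nr i)) (i : 'I_N) :
    'cV[K]_(nc i + nr i) :=
  col_mx (submxcol (usubmx w) i) (submxcol (dsubmx w) i).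

Section SchurComplement.
Variable S_ : forall i, 'M[K]_(nc i + nr i).

Definition Scc_ i : 'M[K]_(nc i) := ulsubmx (S_ i).
Definition Src_ i : 'M[K]_(nr i, nc i) := dlsubmx (S_ i).
Definition Srr_ i : 'M[K]_(nr i) := drsubmx (S_ i).

Definition Scc : 'M[K]_(\sum_i nc i) := \mxdiag_i Scc_ i.
Definition Src : 'M[K]_(\sum_i nr i, \sum_i nc i) := mxdiag_rect Src_.
Definition Srr : 'M[K]_(\sum_i nr i) := \mxdiag_i Srr_ i.

Definition Smx : 'M[K]_(\sum_i nc i + \sum_i nr i) :=
  block_mx Scc Src^T Src Srr.

Definition aform (u v : 'cV[K]_(\sum_i nc i + \sum_i nr i)) : K :=
  dotv (Smx *m u) v.

Definition posdef_on (V : 'cV[K]_(\sum_i nc i + \sum_i nr i) -> Prop) : Prop :=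
  forall w, V w -> w != 0 -> 0 < aform w w.

End SchurComplement.

(* glob i a is the (interface) global degree of freedom carried by the local  *)
(* degree of freedom a of substructure i; n is the number of global ones.     *)
Section ContinuousSpace.
Context {n : nat}.
Variable glob : forall i, 'I_(nc i + nr i) -> 'I_n.

Definition What (w : 'cV[K]_(\sum_i nc i + \sum_i nr i)) : Prop :=
  forall i j (a : 'I_(nc i + nr i)) (b : 'I_(nc j + nr j)),
    glob a = glob b -> local w i a 0 = local w j b 0.

(* The embedding of What, coordinatized by the global degrees of freedom.     *)
Definition Rmx : 'M[K]_(\sum_i nc i + \sum_i nr i, n) :=
  glue (fun i => \matrix_(a, k) (glob a == k)%:R).

End ContinuousSpace.

(* cglob i a is the global coarse degree of freedom carried by the local      *)
(* coarse degree of freedom a of substructure i.                              *)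
Section CoarseSpace.
Context {m : nat}.
Variable cglob : forall i, 'I_(nc i) -> 'I_m.

Definition Rc_ i : 'M[K]_(nc i, m) := \matrix_(a, k) (cglob a == k)%:R.
Definition Rc : 'M[K]_(\sum_i nc i, m) := \mxcol_i Rc_ i.

Definition Wtilde (w : 'cV[K]_(\sum_i nc i + \sum_i nr i)) : Prop :=
  exists (uc : 'cV[K]_m) (ur : 'cV[K]_(\sum_i nr i)), w = col_mx (Rc *m uc) ur.

Variable S_ : forall i, 'M[K]_(nc i + nr i).

Definition Scc_tilde : 'M[K]_m :=
  \sum_i ((Rc_ i)^T *m Scc_ S_ i *m Rc_ i).

Definition Scc_star : 'M[K]_m :=
  Scc_tilde - Rc^T *m (Src S_)^T *m invmx (Srr S_) *m Src S_ *m Rc.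

Definition is_coarse_basis (Psi : 'M[K]_(\sum_i nc i + \sum_i nr i, m)) : Prop :=
  usubmx Psi = Rc /\
  forall Phi : 'M[K]_(\sum_i nc i + \sum_i nr i, m), usubmx Phi = Rc ->
    \tr (Psi^T *m Smx S_ *m Psi) <= \tr (Phi^T *m Smx S_ *m Phi).

End CoarseSpace.

Section Preconditioners.
Context {n m : nat}.
Variable glob : forall i, 'I_(nc i + nr i) -> 'I_n.
Variable cglob : forall i, 'I_(nc i) -> 'I_m.
Variable S_ : forall i, 'M[K]_(nc i + nr i).
Variable DP : 'M[K]_(\sum_i nc i + \sum_i nr i).

Definition Emx : 'M[K]_(n, \sum_i nc i + \sum_i nr i) := (Rmx glob)^T *m DP.
Definition Er : 'M[K]_(n, \sum_i nr i) := Emx *m col_mx 0 1%:M.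
Definition Ec : 'M[K]_(n, m) := Emx *m col_mx (Rc cglob) 0.

Definition M_PFETIDP : 'M[K]_n :=
  Er *m invmx (Srr S_) *m Er^T
  + (Ec - Er *m invmx (Srr S_) *m Src S_ *m Rc cglob)
    *m invmx (Scc_star cglob S_)
    *m (Ec^T - (Rc cglob)^T *m (Src S_)^T *m invmx (Srr S_) *m Er^T).

Definition M_BDDC (Psi : 'M[K]_(\sum_i nc i + \sum_i nr i, m)) : 'M[K]_n :=
  Er *m invmx (Srr S_) *m Er^T
  + Emx *m Psi *m invmx (Psi^T *m Smx S_ *m Psi) *m Psi^T *m Emx^T.

End Preconditioners.
End Substructuring.

(* Main.v *)
Require Import Defs.
From HB Require Import structures.
From mathcomp Require Import all_boot all_order all_algebra.
From mathcomp Require Import reals.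

Set Implicit Arguments.
Unset Strict Implicit.
Unset Printing Implicit Defensive.

Import Order.TTheory GRing.Theory Num.Theory.
Local Open Scope ring_scope.

(** Completing the square in the remaining components shows that the energy
    minimizer with coarse block [Rc] is [Psi = (Rc; - Srr^-1 Src Rc)].  Hence
    [E Psi = Ec - Er Srr^-1 Src Rc], and [Psi^T S Psi] is the Schur complement
    [Scc_star], so the two preconditioners agree factor by factor. *)

Definition posdef (K : realType) (p : nat) (A : 'M[K]_p) : Prop :=
  forall u : 'cV[K]_p, u != 0 -> 0 < dotv (A *m u) u.

Section PositiveDefinite.
Variables (K : realType) (p : nat) (A : 'M[K]_p).
Hypothesis A_pos : posdef A.

(** A nonzero row of the left kernel of [A^T], once transposed, would be a nonzero vector of zero
    energy. *)
Lemma posdef_unitmx : A \in unitmx.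
Proof.
rewrite -unitmx_tr -row_free_unit -kermx_eq0; apply/eqP/row_matrixP => i.
rewrite row0; apply/eqP; apply: contraT => ui0.
have := A_pos (u := (row i (kermx A^T))^T).
rewrite trmx_eq0 => /(_ ui0).
by rewrite -{1}[A]trmxK -trmx_mul -row_mul mulmx_ker row0 /dotv !trmx0 mul0mx mxE ltxx.
Qed.

(** The diagonal entries of [D^T A D] are the energies of the columns of [D]; nonnegative numbers
    with nonpositive sum all vanish. *)
Lemma posdef_trace_le0 (q : nat) (D : 'M[K]_(p, q)) :
  \tr (D^T *m A *m D) <= 0 -> D = 0.
Proof.
have diagE j : (D^T *m A *m D) j j = dotv (A *m col j D) (col j D).
  transitivity (((col j D)^T *m A *m col j D) 0 0).
    by rewrite colE trmx_mul trmx_delta !mulmxA -colE -!mulmxA -rowE !mxE.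
  (* A 1 by 1 matrix equals its transpose, which turns [v^T A v] into [(A v)^T v]. *)
  by rewrite /dotv -[(col j D)^T *m A *m _]trmxK [LHS]mxE !trmx_mul trmxK mulmxA.
have diag_ge0 j : 0 <= (D^T *m A *m D) j j.
  rewrite diagE; have [-> | /A_pos/ltW //] := eqVneq (col j D) 0.
  by rewrite /dotv mulmx0 mxE.
move=> tr_le0; have tr0 : \tr (D^T *m A *m D) == 0.
  by rewrite eq_le tr_le0 sumr_ge0.
move: tr0; rewrite psumr_eq0 // => /allP diag0.
apply/matrixP => i j; rewrite [RHS]mxE.
have := diag0 j (mem_index_enum j); rewrite /= diagE.
have [/colP/(_ i) | /A_pos/gt_eqF -> //] := eqVneq (col j D) 0.
by rewrite !mxE.
Qed.

End PositiveDefinite.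

Section SchurComplement.
Variables (K : realType) (N : nat) (nc nr : 'I_N -> nat).
Variable S_ : forall i, 'M[K]_(nc i + nr i).

Lemma Srr_sym : (forall i, sym_psd (S_ i)) -> (Srr S_)^T = Srr S_.
Proof.
move=> S_psd; rewrite /Srr tr_mxdiag; apply: eq_mxdiag => i.
by rewrite /Srr_ trmx_drsub (S_psd i).1.
Qed.

Variables (m : nat) (cglob : forall i, 'I_(nc i) -> 'I_m).

(** Vectors with zero coarse part lie in [Wtilde], and there the form [a] reduces to that of
    [Srr]. *)
Lemma Srr_posdef : posdef_on S_ (Wtilde cglob) -> posdef (Srr S_).
Proof.
move=> a_pos u u0; have := a_pos (col_mx 0 u).
rewrite col_mx_eq0 eqxx /= /aform /dotv /Smx mul_block_col.
rewrite !mulmx0 !add0r tr_col_mx mul_row_col mulmx0 add0r; apply => //.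
by exists 0, u; rewrite mulmx0.
Qed.

Lemma Scc_tildeE :
  Scc_tilde cglob S_ = (Rc cglob)^T *m Scc S_ *m Rc cglob.
Proof. by rewrite /Rc tr_mxcol /Scc mul_mxrow_mxdiag mul_mxrow_mxcol. Qed.

(** Discrete harmonic extension of the coarse unit vectors: the remaining rows of
    [Smx S_ *m harmonic_ext] vanish when [Srr] is invertible. *)
Definition harmonic_ext : 'M[K]_(\sum_i nc i + \sum_i nr i, m) :=
  col_mx (Rc cglob) (- (invmx (Srr S_) *m Src S_ *m Rc cglob)).

Hypothesis S_sym : (Srr S_)^T = Srr S_.
Hypothesis S_pos : posdef (Srr S_).

(** [D] is an arbitrary perturbation keeping the coarse block. Harmonicity removes the cross terms;
    taking traces gives minimality, and [D = 0] gives the coarse matrix. *)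
Lemma Smx_harmonic_ext_energy (D : 'M[K]_(\sum_i nr i, m)) :
  let Phi := harmonic_ext + col_mx 0 D in
  Phi^T *m Smx S_ *m Phi = Scc_star cglob S_ + D^T *m Srr S_ *m D.
Proof.
have Srr_unit := posdef_unitmx S_pos.
rewrite /= /harmonic_ext add_col_mx addr0 tr_col_mx /Smx mul_row_block mul_row_col.
rewrite /Scc_star Scc_tildeE.
set Z := invmx _ *m _ *m _.
have SZ : Srr S_ *m Z = Src S_ *m Rc cglob by rewrite /Z -mulmxA mulKVmx.
have ZS : Z^T *m Srr S_ = (Rc cglob)^T *m (Src S_)^T.
  by rewrite -{1}S_sym -trmx_mul SZ trmx_mul.
have -> : (Rc cglob)^T *m (Src S_)^T *m invmx (Srr S_) *m Src S_ *m Rc cglob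
   = Z^T *m Src S_ *m Rc cglob.
  by rewrite -ZS mulmxK.
rewrite [(- Z + D)^T]linearD linearN /= (mulmxDl _ _ (Srr S_)) (mulNmx _ (Srr S_)).
(* By [ZS] the remaining block of [Phi^T S] collapses to [D^T Srr]; by [SZ] its product with [- Z]
   cancels [D^T Src Rc]. *)
rewrite ZS addrA subrr add0r mulmxDr mulmxN -(mulmxA D^T _ Z) SZ !mulmxDl mulNmx mulmxA.
by rewrite !addrA addrK mulNmx.
Qed.

Lemma coarse_basisE Psi : is_coarse_basis cglob S_ Psi -> Psi = harmonic_ext.
Proof.
case=> Psi_c Psi_min; pose D := dsubmx Psi - dsubmx harmonic_ext.
have PsiE : Psi = harmonic_ext + col_mx 0 D.
  by rewrite /D /harmonic_ext col_mxKd add_col_mx addr0 addrC subrK -Psi_c vsubmxK.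
(* With [harmonic_ext] as competitor, minimality says that the trace of [D^T Srr D] is at most 0. *)
have := Psi_min harmonic_ext (col_mxKu _ _).
have := Smx_harmonic_ext_energy 0; rewrite /= col_mx0 addr0 => ->.
rewrite PsiE Smx_harmonic_ext_energy mulmx0 addr0 linearD /= gerDl.
by move/(posdef_trace_le0 S_pos) ->; rewrite col_mx0 addr0.
Qed.

End SchurComplement.

Theorem theorem6p2 (K : realType) (N n m : nat) (nc nr : 'I_N -> nat)
    (S_ : forall i, 'M[K]_(nc i + nr i))
    (glob : forall i, 'I_(nc i + nr i) -> 'I_n)
    (cglob : forall i, 'I_(nc i) -> 'I_m)
    (DP : 'M[K]_(\sum_i nc i + \sum_i nr i))
    (Psi : 'M[K]_(\sum_i nc i + \sum_i nr i, m))
    (S_psd : forall i, sym_psd (S_ i))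
    (cglob_onto : forall k : 'I_m, exists i, exists a, cglob i a = k)
    (What_sub : forall w : 'cV[K]_(\sum_i nc i + \sum_i nr i),
       What glob w -> Wtilde cglob w)
    (a_What : posdef_on S_ (What glob))
    (a_Wtilde : posdef_on S_ (Wtilde cglob))
    (ER1 : Emx glob DP *m Rmx glob = 1%:M)
    (Psi_basis : is_coarse_basis cglob S_ Psi) :
  M_PFETIDP glob cglob S_ DP = M_BDDC glob S_ DP Psi.
Proof.
have S_sym := Srr_sym S_psd.
have S_pos := Srr_posdef a_Wtilde.
have EPsi : Emx glob DP *m Psi
    = Ec glob cglob DP - Er glob DP *m invmx (Srr S_) *m Src S_ *m Rc cglob.
  rewrite (coarse_basisE S_sym S_pos Psi_basis) /Ec /Er /Emx -!mulmxA -!mulmxBr.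
  rewrite mul_col_mx mul0mx mul1mx /harmonic_ext.
  by rewrite opp_col_mx add_col_mx subr0 sub0r !mulmxA.
have PsiSPsi : Psi^T *m Smx S_ *m Psi = Scc_star cglob S_.
  have := Smx_harmonic_ext_energy cglob S_sym S_pos 0.
  by rewrite /= col_mx0 addr0 mulmx0 addr0 -(coarse_basisE S_sym S_pos Psi_basis).
(* The right factor [Psi^T E^T] is the transpose of [E Psi]; symmetry of [Srr] brings it to the
   P-FETI-DP form. *)
rewrite /M_PFETIDP /M_BDDC PsiSPsi -(mulmxA _ Psi^T) -(trmx_mul _ Psi) EPsi.
rewrite [(Ec _ _ _ - _)^T]linearB /=.
by rewrite (trmx_mul _ (Rc _)) (trmx_mul _ (Src _)) (trmx_mul _ (invmx _)) trmx_inv S_sym !mulmxA.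
Qed.
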